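(* Let $n\in\mathbb{N}$. The following are equivalent: (i) $n$ is squarefree; (ii) there exists $M$ (depending on $n$) such that $N_1(m)\equiv 0 \pmod n$ for all $m\in V$ with $m>M$.
   Context: $\phi$ denotes Euler's totient function and $V=\{\phi(m): m\in\mathbb{N}\}$ is its image. For $m\in V$, $N_1(m)=\max\{x\in\mathbb{N}:\phi(x)\le m\}$, and $N_1=\{N_1(m): m\in V\}$; elements of $N_1$ are called sparsely totient numbers. *)

(* Defs.v *)
From mathcomp Require Import all_boot.
Set Implicit Arguments.
Unset Strict Implicit.
Unset Printing Implicit Defensive.

(* The natural numbers of the source are the positive integers, whereas
   [totient 0 = 0] in the library: hence the positivity conditions below. *)

Definition V (m : nat) : Prop := exists2 x, 0 < x & totient x = m.

Definition squarefree (n : nat) : Prop := forall d, d ^ 2 %| n -> d = 1.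

Definition totient_le (m : nat) : pred nat :=
  fun x => (0 < x) && (totient x <= m).

Lemma totient_le_nonempty m : V m -> exists x, totient_le m x.
Proof.
by case=> x x_gt0 <-; exists x; rewrite /totient_le x_gt0 leqnn.
Qed.

(* Every prime power [p ^ k] exactly dividing [x] satisfies
   [(p - 1) * p ^ (k - 1) <= totient x], so that [p <= m + 1] and [k <= m]. *)
Lemma totient_le_bounded m x : totient_le m x -> x <= (m.+1)`! ^ m.
Proof.
case/andP=> x_gt0 le_m; apply: dvdn_leq; first by rewrite expn_gt0 fact_gt0.
apply/(dvdn_partP _ x_gt0) => p.
rewrite mem_primes => /and3P[p_pr _ p_dvd].
have k_gt0 : 0 < logn p x by rewrite logn_gt0 mem_primes p_pr x_gt0.
have p_gt1 := prime_gt1 p_pr.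
have : totient x`_p <= m.
  apply: leq_trans le_m; rewrite -{2}(partnC p x_gt0).
  rewrite totient_coprime ?coprime_partC // leq_pmulr //.
  by rewrite totient_gt0 part_gt0.
rewrite p_part totient_pfactor // => le_pk.
have pX_gt0 : 0 < p ^ (logn p x).-1 by rewrite expn_gt0 prime_gt0.
have p1_gt0 : 0 < p.-1 by rewrite -ltnS prednK // prime_gt0.
have le_p : p <= m.+1.
  rewrite -(prednK (prime_gt0 p_pr)) ltnS.
  exact: leq_trans (leq_pmulr _ pX_gt0) le_pk.
have le_k : logn p x <= m.
  rewrite -(prednK k_gt0); apply: leq_trans (ltn_expl _ p_gt1) _.
  exact: leq_trans (leq_pmull _ p1_gt0) le_pk.
apply: dvdn_trans (dvdn_exp2l p le_k) _.
by rewrite dvdn_exp2r // dvdn_fact // prime_gt0.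
Qed.

(* [N1 m mV] is N_1(m) for [mV : V m]; it does not depend on the proof [mV],
   being the maximum of [totient_le m] (see [ex_maxnP]). *)
Definition N1 (m : nat) (mV : V m) : nat :=
  ex_maxn (totient_le_nonempty mV) (@totient_le_bounded m).
Arguments N1 m mV : clear implicits.

(* Main.v *)
Require Import Defs.
From mathcomp Require Import all_boot zify.

(** A number [N = N_1 m] is sparsely totient: [totient x <= totient N] forces
    [x <= N].

    If a prime [p] does not divide such an [N], then replacing a divisor [d] of
    [N] by [k * p], with [k = (d - 1) / (p - 1)], yields a number with no larger
    totient as soon as [(d - 1) * totient (N / d) <= totient N]; it exceeds [N]
    when [d > p * (p - 1)]. Taking for [d] a prime exactly dividing [N], or
    [q ^ (e - 1)] with [q ^ e] exactly dividing [N], bounds the primes of [N] and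
    their exponents, hence [N]. So every prime divides all large [N_1 m].

    Conversely the primorials are sparsely totient: a number [x] with no more
    prime factors than [P] has [totient x / x >= totient P / P], and one with
    more prime factors has [totient x > totient P]. Being squarefree, they are
    not divisible by the square of a prime. *)

(** * Submultiplicativity of the totient *)

Lemma totient_pfactor_mul p e c : prime p -> coprime p c ->
  totient (p ^ e.+1 * c) = p.-1 * p ^ e * totient c.
Proof.
by move=> p_pr cop; rewrite totient_coprime ?coprimeXl // totient_pfactor.
Qed.

Lemma pfactor_decomp p n : prime p -> 0 < n ->
  exists2 c, coprime p c & n = p ^ logn p n * c.
Proof.
move=> p_pr n_gt0; have [c cop def_n] := pfactor_coprime p_pr n_gt0.
by exists c => //; rewrite mulnC.
Qed.

(** The factor gained is [p.-1] when [p] does not divide [c] and exactly [p] when it does. *)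
Lemma totient_prime_mul_le p c : prime p -> totient (p * c) <= p * totient c.
Proof.
move=> p_pr; have [->|c_gt0] := posnP c; first by rewrite muln0.
have [c' cop def_c] := pfactor_decomp p c p_pr c_gt0.
rewrite {}def_c mulnA -expnS totient_pfactor_mul //.
case: (logn p c) => [|e].
  by rewrite !expn0 muln1 mul1n leq_mul2r leq_pred orbT.
by rewrite totient_pfactor_mul // expnS !mulnA (mulnC p.-1 p).
Qed.

Lemma totient_mul_le a c : totient (a * c) <= a * totient c.
Proof.
elim/ltn_ind: a => a IHa.
have [a_le1|a_gt1] := leqP a 1.
  by case: a a_le1 {IHa} => [|[|]] // _; rewrite ?mul0n ?mul1n.
have p_pr := pdiv_prime a_gt1.
have /dvdnP[b def_a] := pdiv_dvd a; set p := pdiv a in p_pr def_a; clearbody p.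
have lt_ba : b < a.
  by rewrite def_a ltn_Pmulr ?prime_gt1 //; case: b def_a a_gt1 => // ->.
rewrite def_a (mulnC b) -!mulnA.
apply: leq_trans (totient_prime_mul_le _ _ p_pr) _.
by rewrite leq_mul2l IHa ?orbT.
Qed.

(** * Sparsely totient numbers as the values of [N1] *)

Definition sparsely_totient (n : nat) : Prop :=
  0 < n /\ forall x, totient x <= totient n -> x <= n.

Lemma N1_ge m (mV : V m) x : 0 < x -> totient x <= m -> x <= N1 m mV.
Proof.
move=> x_gt0 le_x; rewrite /N1; case: ex_maxnP => N _; apply.
by rewrite /totient_le x_gt0.
Qed.

Lemma totient_N1_le m (mV : V m) : totient_le m (N1 m mV).
Proof. by rewrite /N1; case: ex_maxnP. Qed.

Lemma N1_sparsely_totient m (mV : V m) : sparsely_totient (N1 m mV).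
Proof.
have /andP[N_gt0 le_N] := totient_N1_le m mV; split=> // -[|x] // le_x.
by apply: N1_ge => //; apply: leq_trans le_N.
Qed.

Lemma totient_leq x : totient x <= x.
Proof. by have := totient_mul_le x 1; rewrite !muln1. Qed.

Lemma leq_N1 m (mV : V m) : m <= N1 m mV.
Proof.
case: (mV) => x x_gt0 def_m; apply: (@leq_trans x).
  by rewrite -def_m totient_leq.
by rewrite N1_ge ?def_m.
Qed.

Lemma N1_totient n (nV : V (totient n)) :
  sparsely_totient n -> N1 (totient n) nV = n.
Proof.
case=> n_gt0 n_max; apply/eqP; rewrite eqn_leq N1_ge // andbT n_max //.
by have /andP[] := totient_N1_le _ nV.
Qed.

(** * Bounding a sparsely totient number that misses a prime *)

Lemma sparsely_totient_divisor_bound n p d c :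
    sparsely_totient n -> prime p -> ~~ (p %| n) -> n = d * c ->
    d.-1 * totient c <= totient n ->
  d <= p * p.-1.
Proof.
move=> [n_gt0 n_max] p_pr p_ndvd def_n le_dc; rewrite leqNgt; apply/negP => lt_d.
have p_gt1 := prime_gt1 p_pr.
have c_gt0 : 0 < c by move: n_gt0; rewrite def_n muln_gt0 => /andP[].
have cop : coprime p c.
  by rewrite prime_coprime //; apply: contra p_ndvd => ?; rewrite def_n dvdn_mull.
pose k := d.-1 %/ p.-1.
have k_le : k * p.-1 <= d.-1 by rewrite leq_divM.
have k_lt : d.-1 < k.+1 * p.-1 by rewrite ltn_ceil //; lia.
have k_ge : p <= k by rewrite leq_divRL; lia.
(* Since [p <= k], the product [k.+1 * p.-1] is at most [k * p - 1], and it exceeds [d.-1]. *)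
have lt_kp : d < k * p by nia.
suff /n_max : totient (k * (p * c)) <= totient n.
  by rewrite mulnA leqNgt def_n ltn_mul2r c_gt0 lt_kp.
apply: leq_trans (totient_mul_le _ _) (leq_trans _ le_dc).
by rewrite totient_coprime // totient_prime // mulnA leq_mul2r k_le orbT.
Qed.

Lemma sparsely_totient_bound n p b :
    sparsely_totient n -> prime p -> ~~ (p %| n) -> p * p.-1 <= b ->
  n <= b`! ^ b.+1.
Proof.
move=> st_n p_pr p_ndvd le_b; have n_gt0 := st_n.1.
(* Divisibility is checked prime by prime: each prime of [n] is at most [b], hence divides the
   factorial, and its exponent is at most [b.+1]. *)
apply: dvdn_leq; first by rewrite expn_gt0 fact_gt0.
apply/(dvdn_partP _ n_gt0) => q; rewrite mem_primes => /and3P[q_pr _ q_dvd].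
have q_gt0 := prime_gt0 q_pr; have q_gt1 := prime_gt1 q_pr.
have [c cop def_n] := pfactor_decomp q n q_pr n_gt0.
have bound d c' : n = d * c' -> d.-1 * totient c' <= totient n -> d <= b.
  move=> nE le_n; apply: leq_trans le_b.
  exact: (sparsely_totient_divisor_bound n p d c').
have : 0 < logn q n by rewrite logn_gt0 mem_primes q_pr n_gt0.
rewrite p_part; case: (logn q n) def_n => [|[|e]] // def_n _.
  have le_q : q <= b.
    by apply: (bound _ _ def_n); rewrite def_n totient_pfactor_mul // expn0 muln1.
  rewrite (dvdn_trans (dvdn_exp2l q (ltn0Sn b))) // dvdn_exp2r //.
  by rewrite dvdn_fact // q_gt0.
(* One factor [q] stays in the cofactor, so that [totient n] is exactly
   [q ^ e.+1 * totient (q * c)]; removing the full power would violate the hypothesis on [d]. *)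
have le_qe : q ^ e.+1 <= b.
  apply: (bound _ (q * c)); first by rewrite mulnA -expnSr.
  rewrite def_n totient_pfactor_mul // totient_coprime // totient_prime //.
  by rewrite mulnA leq_mul2r (mulnC q.-1) leq_mul2r leq_pred !orbT.
have le_q : q <= b.
  by apply: leq_trans le_qe; rewrite expnS leq_pmulr // expn_gt0 q_gt0.
have le_e : e.+2 <= b.+1.
  by rewrite ltnS; apply: leq_trans (ltnW (ltn_expl _ q_gt1)) le_qe.
by rewrite (dvdn_trans (dvdn_exp2l q le_e)) // dvdn_exp2r // dvdn_fact // q_gt0.
Qed.

Lemma squarefree_dvdn n a : 0 < n -> squarefree n ->
  (forall p, prime p -> p %| n -> p %| a) -> n %| a.
Proof.
move=> n_gt0 sf_n dvd_a; apply/(dvdn_partP _ n_gt0) => p.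
rewrite mem_primes => /and3P[p_pr _ p_dvd]; rewrite p_part.
have : logn p n <= 1.
  rewrite leqNgt; apply/negP => lt1.
  have /sf_n p1 : p ^ 2 %| n by rewrite pfactor_dvdn.
  by rewrite p1 in p_pr.
case: (logn p n) => [|[|]] // _.
exact: dvd_a.
Qed.

(** * Comparing products over sets of primes *)

(** Pairing the entries, [b <= a] gives [a * b.-1 <= a.-1 * b]; the unpaired entries of [B] only
    help. *)
Lemma prod_ratio_le (A B : seq nat) :
    size A <= size B -> {in A & B, forall a b, b <= a} ->
  (\prod_(q <- A) q) * (\prod_(q <- B) q.-1)
    <= (\prod_(q <- A) q.-1) * (\prod_(q <- B) q).
Proof.
elim: A B => [|a A IHA] [|b B] //= le_AB ge_AB.
- by rewrite !big_nil.
- by rewrite !big_nil !mul1n; apply: leq_prod => q _; apply: leq_pred.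
rewrite !big_cons mulnACA [leqRHS]mulnACA; apply: leq_mul.
  by have := ge_AB a b (mem_head _ _) (mem_head _ _); lia.
by apply: IHA => // x y xA yB; apply: ge_AB; rewrite inE ?xA ?yB orbT.
Qed.

(** Paired factors compare termwise, and each surplus factor from [A] is at least 2, whence
    strictness. *)
Lemma prod_pred_lt (A B : seq nat) :
    size B < size A -> {in A, forall a, 2 < a} -> {in A & B, forall a b, b <= a} ->
  \prod_(q <- B) q.-1 < \prod_(q <- A) q.-1.
Proof.
elim: A B => [|a A IHA] B //= lt_BA A_gt2 ge_AB.
have a_gt2 := A_gt2 a (mem_head _ _).
have A'_gt2 : {in A, forall x, 2 < x}.
  by move=> x xA; apply: A_gt2; rewrite inE xA orbT.
have A_gt0 : 0 < \prod_(q <- A) q.-1.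
  by rewrite big_seq prodn_cond_gt0 // => q /A'_gt2; lia.
case: B lt_BA ge_AB => [|b B] /= lt_BA ge_AB; rewrite !big_cons.
  by rewrite big_nil; nia.
have le_ba : b <= a by apply: ge_AB; apply: mem_head.
have {}IHA : \prod_(q <- B) q.-1 < \prod_(q <- A) q.-1.
  by apply: IHA => // x y xA yB; apply: ge_AB; rewrite inE ?xA ?yB orbT.
by nia.
Qed.

Lemma prod_splitI (S T : seq nat) (f : nat -> nat) :
  \prod_(q <- S) f q =
    (\prod_(q <- [seq q <- S | q \in T]) f q) *
    (\prod_(q <- [seq q <- S | q \notin T]) f q).
Proof. by rewrite (bigID (mem T)) /= !big_filter. Qed.

Lemma perm_filter_mem (S T : seq nat) : uniq S -> uniq T ->
  perm_eq [seq q <- S | q \in T] [seq q <- T | q \in S].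
Proof.
move=> uS uT; apply: uniq_perm; rewrite ?filter_uniq // => q.
by rewrite !mem_filter andbC.
Qed.

(** Euler's product for [totient x / x], cleared of denominators. *)
Lemma totient_mul_prod_primes x : 0 < x ->
  totient x * \prod_(p <- primes x) p = x * \prod_(p <- primes x) p.-1.
Proof.
move=> x_gt0.
have def_x : x = \prod_(p <- primes x) p ^ logn p x.
  by rewrite {1}(prod_prime_decomp x_gt0) prime_decompE big_map.
rewrite [X in _ = X * _]def_x totientE // -!big_split /=.
apply: eq_big_seq => p p_x; rewrite -mulnA -expnSr prednK ?logn_gt0 //.
by rewrite mulnC.
Qed.

Lemma prod_pred_primes_le x : 0 < x ->
  \prod_(p <- primes x) p.-1 <= totient x.
Proof.
move=> x_gt0; rewrite totientE //; rewrite big_seq [leqRHS]big_seq.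
apply: leq_prod => p; rewrite mem_primes => /and3P[p_pr _ _].
by rewrite leq_pmulr // expn_gt0 prime_gt0.
Qed.

Lemma coprime_prod_primes p (T : seq nat) :
  prime p -> all prime T -> p \notin T -> coprime p (\prod_(q <- T) q).
Proof.
move=> p_pr /allP pr_T pT; rewrite prime_coprime // Euclid_dvd_prod //.
rewrite big_has; apply/hasPn => q qT /=.
by rewrite dvdn_prime2 ?(pr_T q) //; apply: contraNneq pT => ->.
Qed.

Lemma totient_prod_primes (T : seq nat) : uniq T -> all prime T ->
  totient (\prod_(q <- T) q) = \prod_(q <- T) q.-1.
Proof.
elim: T => [|p T IHT] /=; first by rewrite !big_nil.
case/andP=> pT uT /andP[p_pr pr_T]; rewrite !big_cons.
by rewrite totient_coprime ?coprime_prod_primes // totient_prime // IHT.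
Qed.

Lemma prod_primes_squarefree (T : seq nat) p : uniq T -> all prime T ->
  prime p -> ~~ (p ^ 2 %| \prod_(q <- T) q).
Proof.
move=> uT pr_T p_pr; have [pT|pT] := boolP (p \in T); last first.
  apply/negP => /(dvdn_trans (dvdn_mulr p (dvdnn p))); apply/negP.
  by rewrite -prime_coprime // coprime_prod_primes.
rewrite (perm_big _ (perm_to_rem pT)) big_cons /= expnS dvdn_pmul2l ?prime_gt0 //.
rewrite expn1 -prime_coprime // coprime_prod_primes //.
  by apply/allP => q /mem_rem; apply/allP.
by rewrite mem_rem_uniqF.
Qed.

(** * Primorials are sparsely totient *)

Definition primes_upto (y : nat) : seq nat := [seq p <- iota 0 y.+1 | prime p].

Lemma mem_primes_upto y p : (p \in primes_upto y) = prime p && (p <= y).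
Proof. by rewrite mem_filter mem_iota. Qed.

Lemma primes_upto_uniq y : uniq (primes_upto y).
Proof. by rewrite filter_uniq ?iota_uniq. Qed.

Lemma all_prime_primes_upto y : all prime (primes_upto y).
Proof. exact: filter_all. Qed.

Definition primorial (y : nat) : nat := \prod_(p <- primes_upto y) p.

Lemma primorial_sparsely_totient y : 1 < y -> sparsely_totient (primorial y).
Proof.
move=> y_gt1; set T := primes_upto y.
have T_gt1 q : q \in T -> 1 < q by rewrite mem_primes_upto => /andP[/prime_gt1].
have P_gt0 : 0 < primorial y.
  by rewrite /primorial big_seq prodn_cond_gt0 // => q /T_gt1/ltnW.
split=> // x; have [->|x_gt0] := posnP x; first by [].
have totP : totient (primorial y) = \prod_(q <- T) q.-1.
  by rewrite totient_prod_primes ?primes_upto_uniq ?all_prime_primes_upto.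
move=> le_x; set S := primes x.
have S_gt1 q : q \in S -> 1 < q by rewrite mem_primes => /andP[/prime_gt1].
(* Common primes contribute equally to both sides; what remains is [A], lying above [y], against
   [B], lying below. *)
pose A := [seq q <- S | q \notin T]; pose B := [seq q <- T | q \notin S].
have gt_A a : a \in A -> y < a.
  rewrite mem_filter mem_primes_upto mem_primes => /andP[/nandP[|]].
    by move/negP=> npr /and3P[].
  by rewrite -ltnNge.
have le_B b : b \in B -> b <= y.
  by rewrite mem_filter mem_primes_upto => /and3P[].
have ge_AB : {in A & B, forall a b, b <= a}.
  by move=> a b /gt_A lt_a /le_B le_b; apply: ltnW (leq_ltn_trans le_b lt_a).
have A_gt2 : {in A, forall a, 2 < a} by move=> a /gt_A; apply: leq_ltn_trans.
have permC := perm_filter_mem S T (primes_uniq x) (primes_upto_uniq y).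
have prodS f : \prod_(q <- S) f q =
    (\prod_(q <- [seq q <- T | q \in S]) f q) * \prod_(q <- A) f q.
  by rewrite (prod_splitI S T) (perm_big _ permC).
have prodT f : \prod_(q <- T) f q =
    (\prod_(q <- [seq q <- T | q \in S]) f q) * \prod_(q <- B) f q.
  exact: prod_splitI.
have [le_AB|lt_BA] := leqP (size A) (size B); last first.
  have := leq_trans (prod_pred_primes_le x x_gt0) le_x.
  rewrite leqNgt totP prodS prodT ltn_mul2l prod_pred_lt // andbT.
  case/negP; rewrite big_seq prodn_cond_gt0 // => q.
  by rewrite mem_filter => /andP[_ /T_gt1]; case: q => [|[|]].
have ratio : (\prod_(q <- S) q) * (\prod_(q <- T) q.-1)
    <= (\prod_(q <- S) q.-1) * (\prod_(q <- T) q).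
  rewrite !prodS !prodT mulnACA [leqRHS]mulnACA; apply: leq_mul.
    by rewrite mulnC.
  exact: prod_ratio_le.
have radS_gt0 : 0 < \prod_(q <- S) q.
  by rewrite big_seq prodn_cond_gt0 // => q /S_gt1/ltnW.
have totP_gt0 : 0 < totient (primorial y) by rewrite totient_gt0.
have totx := totient_mul_prod_primes x x_gt0.
(* Multiplying by [x] lets Euler's product replace the factors [q.-1] by [totient x]; the product of
   the primes of [x] then cancels. *)
move: ratio; rewrite -totP -/(primorial y) -(leq_pmul2l x_gt0) mulnA.
rewrite [leqRHS]mulnA -totx => ratio.
have {}ratio : x * totient (primorial y) <= totient x * primorial y.
  by rewrite -(leq_pmul2r radS_gt0) mulnAC [leqRHS]mulnAC.
rewrite -(leq_pmul2r totP_gt0); apply: leq_trans ratio _.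
by rewrite mulnC leq_mul2l le_x orbT.
Qed.

Lemma totient_primorial_ge p : prime p -> p.-1 <= totient (primorial p).
Proof.
move=> p_pr; rewrite totient_prod_primes ?primes_upto_uniq ?all_prime_primes_upto //.
rewrite (bigD1_seq p) ?primes_upto_uniq ?mem_primes_upto ?p_pr ?leqnn //=.
rewrite leq_pmulr // big_seq_cond prodn_cond_gt0 // => q.
by rewrite mem_primes_upto -andbA => /and3P[/prime_gt1]; case: q => [|[|]].
Qed.

(** * The equivalence *)

Theorem theorem1 (n : nat) (n_gt0 : 0 < n) :
  squarefree n <->
  (exists M : nat, forall (m : nat) (mV : V m), M < m -> N1 m mV = 0 %[mod n]).
Proof.
split=> [sf_n | [M dvd_N1] d d2_dvd].
  (* The bound for a missing prime with [b = n ^ 2], which serves every prime [p] dividing [n] since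
     [p * p.-1 <= n ^ 2]. *)
  exists ((n ^ 2)`! ^ (n ^ 2).+1) => m mV lt_m; apply/eqP; rewrite mod0n.
  apply: squarefree_dvdn => // p p_pr p_dvd; apply: contraLR lt_m => p_ndvd.
  rewrite -leqNgt; apply: leq_trans (leq_N1 m mV) _.
  apply: sparsely_totient_bound p_pr p_ndvd _; first exact: N1_sparsely_totient.
  have le_p := dvdn_leq n_gt0 p_dvd.
  by rewrite expnS expn1 leq_mul // (leq_trans (leq_pred p)).
apply/eqP; apply: contraT => d_neq1.
have d_gt1 : 1 < d.
  by case: d d2_dvd d_neq1 => [|[|]] //; rewrite exp0n // dvd0n eqn0Ngt n_gt0.
have p_pr := pdiv_prime d_gt1.
have p2_dvd : pdiv d ^ 2 %| n.
  by apply: dvdn_trans d2_dvd; rewrite dvdn_exp2r // pdiv_dvd.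
(* A prime above [M.+1] makes [y.-1], hence the totient of the primorial, exceed [M]. *)
have [y lt_y y_pr] := prime_above M.+1.
have st_P := primorial_sparsely_totient y (prime_gt1 y_pr).
have PV : V (totient (primorial y)) by exists (primorial y) => //; exact: st_P.1.
have lt_M : M < totient (primorial y).
  by apply: leq_trans (totient_primorial_ge y y_pr); lia.
have /eqP := dvd_N1 _ PV lt_M; rewrite N1_totient // mod0n => n_dvd.
have := prod_primes_squarefree (primes_upto y) (pdiv d) (primes_upto_uniq y).
by move=> /(_ (all_prime_primes_upto y) p_pr); rewrite (dvdn_trans p2_dvd n_dvd).
Qed.
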